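(* Let $k\ge 1$ be an integer and let $A_k\in\mathbb{Z}^{(2k+1)\times(4k+2)}$ be the matrix defined below. Then for every $\mathbf{b}\in\mathbb{Z}^{2k+1}$ with $\mathcal{F}_{A_k}(\mathbf{b})\neq\emptyset$, the Graver fiber graph $G:=G_{A_k,\mathbf{b},\mathcal{G}(A_k)}$ satisfies $\lambda(G)=\delta(G)$, i.e. its edge-connectivity equals its minimal degree.
   Context: Let $I_k$ be the $k\times k$ identity matrix and $\mathbf{1}_k\in\mathbb{Z}^k$ the all-ones vector. Define $$A_k=\begin{pmatrix} I_k & I_k & 0 & 0 & -\mathbf{1}_k & \mathbf{0}\\ 0&0&I_k&I_k&\mathbf{0}&-\mathbf{1}_k\\ 0&0&0&0&1&1\end{pmatrix}\in\mathbb{Z}^{(2k+1)\times(4k+2)},$$ where the unlabeled $0$'s are zero blocks of the appropriate sizes (the last two columns are single columns). For $A\in\mathbb{Z}^{d\times n}$ and $\mathbf{b}\in\mathbb{Z}^d$, the fiber is $\mathcal{F}_A(\mathbf{b})=\{\mathbf{u}\in\mathbb{Z}_{\ge0}^n: A\mathbf{u}=\mathbf{b}\}$. For $\mathcal{M}\subset\mathbb{Z}^n$, the fiber graph $G_{A,\mathbf{b},\mathcal{M}}$ is the simple graph with vertex set $\mathcal{F}_A(\mathbf{b})$ in which distinct $\mathbf{u},\mathbf{v}$ are adjacent iff $\mathbf{u}-\mathbf{v}\in\mathcal{M}$ or $\mathbf{v}-\mathbf{u}\in\mathcal{M}$. The partial order $\sqsubseteq$ on $\mathbb{Z}^n$: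 $\mathbf{u}\sqsubseteq\mathbf{v}$ iff $u_iv_i\ge0$ and $|u_i|\le|v_i|$ for all $i$. The Graver basis $\mathcal{G}(A)$ is the set of $\sqsubseteq$-minimal elements of $(\ker(A)\cap\mathbb{Z}^n)\setminus\{\mathbf{0}\}$. For a finite graph $G$, $\delta(G)$ is the minimum vertex degree. $G$ is $\ell$-edge-connected if it has more than one vertex and $G$ minus any set of fewer than $\ell$ edges is connected; $\lambda(G)$ is the largest $\ell$ such that $G$ is $\ell$-edge-connected (with $\lambda=0$ for a one-vertex graph). *)

(* Defs.v *)
From HB Require Import structures.
From mathcomp Require Import all_boot all_order all_algebra.
From mathcomp Require Import finmap.
Set Implicit Arguments. Unset Strict Implicit. Unset Printing Implicit Defensive.
Import Order.TTheory GRing.Theory Num.Theory.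

Local Open Scope ring_scope.

(** Entries of A_k, 0-indexed.  Columns: 0..k-1 (first I_k), k..2k-1 (second I_k),
    2k..3k-1 (third I_k), 3k..4k-1 (fourth I_k), 4k, 4k+1 (the two single columns).
    Rows: 0..k-1, k..2k-1, 2k. *)
Definition Ak_entry (k i j : nat) : int :=
  if (i < k)%N then
    (if (j == i) || (j == k + i)%N then 1 else if j == (4 * k)%N then -1 else 0)
  else if (i < 2 * k)%N then
    (if (j == k + i)%N || (j == 2 * k + i)%N then 1
     else if j == (4 * k).+1 then -1 else 0)
  else (if (j == 4 * k)%N || (j == (4 * k).+1) then 1 else 0).

Definition A_k (k : nat) : 'M[int]_((2 * k).+1, (4 * k).+2) :=
  \matrix_(i, j) Ak_entry k i j.

Definition in_fiber (d n : nat) (A : 'M[int]_(d, n)) (b : 'cV[int]_d) (u : 'cV[int]_n) : Prop :=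
  (forall i, 0 <= u i 0) /\ A *m u = b.

Definition conf_le (n : nat) (u v : 'cV[int]_n) : Prop :=
  forall i, 0 <= u i 0 * v i 0 /\ `|u i 0| <= `|v i 0|.

Definition graver (d n : nat) (A : 'M[int]_(d, n)) (v : 'cV[int]_n) : Prop :=
  A *m v = 0 /\ v <> 0 /\
  forall w : 'cV[int]_n, A *m w = 0 -> w <> 0 -> conf_le w v -> w = v.

Definition fiber_adj (n : nat) (M : 'cV[int]_n -> Prop) (u v : 'cV[int]_n) : Prop :=
  u <> v /\ (M (u - v) \/ M (v - u)).

Local Open Scope fset_scope.

Section Graph.
Variable T : choiceType.

Fixpoint walk (R : T -> T -> Prop) (x : T) (p : seq T) : Prop :=
  match p with
  | [::] => True
  | y :: p' => R x y /\ walk R y p'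
  end.

Definition connected_without (V : {fset T}) (E : T -> T -> Prop) (F : {fset T * T}) : Prop :=
  forall u v, u \in V -> v \in V ->
    exists p : seq T, all (fun x => x \in V) p /\ last u p = v /\
      walk (fun x y => E x y /\ (x, y) \notin F /\ (y, x) \notin F) u p.

Definition l_edge_connected (V : {fset T}) (E : T -> T -> Prop) (l : nat) : Prop :=
  (1 < #|` V|)%N /\ forall F : {fset T * T}, (#|` F| < l)%N -> connected_without V E F.

Definition is_edge_connectivity (V : {fset T}) (E : T -> T -> Prop) (l : nat) : Prop :=
  (l_edge_connected V E l /\ forall m, l_edge_connected V E m -> (m <= l)%N)
  \/ (#|` V| <= 1 /\ l = 0)%N.

Definition has_degree (V : {fset T}) (E : T -> T -> Prop) (u : T) (d : nat) : Prop :=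
  exists N : {fset T}, (forall v, v \in N <-> (v \in V /\ E u v)) /\ #|` N| = d.

Definition is_min_degree (V : {fset T}) (E : T -> T -> Prop) (d : nat) : Prop :=
  (exists u, u \in V /\ has_degree V E u d) /\
  forall u e, u \in V -> has_degree V E u e -> (d <= e)%N.

End Graph.

(* Main.v *)
(** Write a vertex as pairs of entries (x_i, y_i), (z_i, w_i) with prescribed sums s + b_i, t + c_i
    and levels s + t = N.  The Graver basis consists of the moves inside one pair (grid moves, which
    keep the level) and of the moves changing (s, t) by (1, -1) or (-1, 1) together with one entry of
    each pair (level moves).  Let D(u) be the set of pairs of u with positive sum, and e = 1 if the
    fiber meets several levels, e = 0 otherwise.

    A corner at an extremal level has degree at most |D| + e 2^k there.  Conversely, let a vertex set S
    be cut from its complement.  If S separates two points of one level, some grid edge u -> v leaves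
    S, and translating it by the other moves of u gives |D(u)| + e 2^k edge-disjoint paths from u to v.
    Otherwise S contains a whole level and misses the next one, and all edges between these levels
    are cut, among which |D(u)| + 2^k are easily listed.  As |D(u)| is at least |D| at a suitable
    extremal level, every cut has at least as many edges as the minimal degree. *)

Require Import Defs.
From mathcomp Require Import all_boot all_order all_algebra.
From mathcomp Require Import finmap zify.
Set Implicit Arguments. Unset Strict Implicit. Unset Printing Implicit Defensive.
Import Order.TTheory GRing.Theory Num.Theory.
Local Open Scope ring_scope.
Local Open Scope fset_scope.

(** * Edge cuts and edge connectivity *)

(* Listing the edges of a cut as pairs (x, y) with x in S and y outside counts each edge once. *)
Definition crossing (T : eqType) (e : rel T) (S : pred T) (C : seq (T * T)) : Prop :=
  uniq C /\ forall p, p \in C -> [&& S p.1, ~~ S p.2 & e p.1 p.2].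

(* The paths u -> a i -> b i -> v, where possibly a i = b i, and the edge u -> v are edge-disjoint,
   and each of them leaves S. *)
Lemma crossing_of_paths (T : eqType) (e : rel T) (S : pred T) (I : finType)
    (a b : I -> T) (u v : T) :
  S u -> ~~ S v -> e u v -> injective a -> injective b ->
  (forall i, [/\ a i != u, a i != v, b i != u & b i != v]) ->
  (forall i, [/\ e u (a i), a i != b i -> e (a i) (b i) & e (b i) v]) ->
  exists2 C, crossing e S C & size C = #|I|.+1.
Proof.
move=> Su Sv euv inja injb nab eab.
pose c i := if ~~ S (a i) then (u, a i) else if ~~ S (b i) then (a i, b i) else (b i, v).
exists ((u, v) :: [seq c i | i <- enum I]); last by rewrite /= size_map -cardE.
split=> [|p].
  rewrite /= map_inj_uniq ?enum_uniq ?andbT => [|i j].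
    apply/mapP=> -[i _]; rewrite /c; have [/eqP au /eqP av /eqP bu /eqP bv] := nab i.
    by do 2?case: ifP => _; case; congruence.
  rewrite /c; have [/eqP au /eqP av /eqP bu /eqP bv] := nab i.
  have [/eqP au' /eqP av' /eqP bu' /eqP bv'] := nab j.
  by do 4?case: ifP => _; case=> *;
    first [congruence | apply: inja; congruence | apply: injb; congruence].
rewrite inE => /predU1P [->|/mapP [i _ ->]]; first by rewrite /= Su Sv.
have [e1 e2 e3] := eab i; rewrite /c; case: ifP => /= Sa; first by rewrite Su Sa.
case: ifP => /= Sb; last by rewrite Sv e3 (negbFE Sb).
rewrite (negbFE Sa) Sb e2 //; apply: contraNneq Sb => <-; exact: negbFE.
Qed.

Section EdgeConnectivity.
Variables (T : choiceType) (V : {fset T}) (E : T -> T -> Prop) (e : rel T).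
Hypothesis eP : forall x y, E x y <-> e x y.

Let nbh u := [fset y in V | e u y].

Let has_degree_nbh u : has_degree V E u #|` nbh u|.
Proof.
exists (nbh u); split=> // y; rewrite !inE /= eP; split; first by case/andP.
by case=> -> ->.
Qed.

Let has_degreeE u d : has_degree V E u d -> d = #|` nbh u|.
Proof.
case=> N [NP <-]; congr #|` _|; apply/fsetP=> y; rewrite !inE /=.
by apply/idP/andP => [/NP [-> /eP ->]//|[yV /eP uy]]; apply/NP.
Qed.

Lemma min_degree_exists : V != fset0 -> exists d, is_min_degree V E d.
Proof.
case/fset0Pn=> u uV.
have ex : exists n, [exists x : V, #|` nbh (val x)| == n].
  by exists #|` nbh u|; apply/existsP; exists [` uV].
case: (ex_minnP ex) => d /existsP [x /eqP dE] dmin; exists d; split.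
  by exists (val x); rewrite -dE; split=> //; exact: valP.
move=> y n yV /has_degreeE ->; apply: dmin; apply/existsP.
by exists [` yV].
Qed.

Lemma min_degree_le d u (s : seq T) : is_min_degree V E d -> u \in V ->
  (forall y, y \in V -> e u y -> y \in s) -> (d <= size s)%N.
Proof.
case=> _ dmin uV us; apply: leq_trans (dmin _ _ uV (has_degree_nbh u)) _.
apply: uniq_leq_size; first exact: fset_uniq.
by move=> y; rewrite !inE => /andP [yV]; exact: us.
Qed.

Hypotheses (eI : irreflexive e).

Lemma connected_without_of_cuts (F : {fset T * T}) :
  (forall (S : pred T) u v, u \in V -> S u -> v \in V -> ~~ S v ->
     exists2 C, crossing (fun x y => [&& x \in V, y \in V & e x y]) S C &
                (#|` F| < size C)%N) ->
  connected_without V E F.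
Proof.
move=> cuts u v uV vV.
pose r := [rel x y : V |
  [&& e (val x) (val y), (val x, val y) \notin F & (val y, val x) \notin F]].
have [/connectP [p pth lst]|nuv] := boolP (connect r [` uV] [` vV]).
  exists [seq val x | x <- p]; split; first by apply/allP=> _ /mapP [x _ ->]; exact: valP.
  split; first by rewrite (last_map val p [` uV]) -lst.
  rewrite -[u in walk _ u _]/(val [` uV]).
  elim: p [` uV] pth {lst} => //= y p IH x /andP [/and3P [exy F1 F2] /IH ?].
  by split=> //; split; first exact: (eP _ _).2 exy.
pose S x := if insub x is Some x' then connect r [` uV] x' else false.
have SE (x : V) : S (val x) = connect r [` uV] x by rewrite /S valK.
have Su : S u by rewrite -[u]/(val [` uV]) SE connect0.
have Sv : ~~ S v by rewrite -[v]/(val [` vV]) SE.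
have [C [Cu CS] CF] := cuts S u v uV Su vV Sv.
(* [f] gives each crossing edge an orientation that occurs in [F]. It is injective on [C], since [S]
   tells the two ends of a crossing edge apart. *)
pose f p := if p \in F then p else (p.2, p.1) : T * T.
move: CF; rewrite ltnNge => /negP []; rewrite -(size_map f C); apply: uniq_leq_size.
  rewrite map_inj_in_uniq // => -[x y] [x' y'] /CS/and3P[/= Sx Sy _] /CS/and3P [/= Sx' Sy' _].
  rewrite /f /=; case: ifP => _; case: ifP => _ // [] ? ?; subst=> //.
  - by rewrite Sx in Sy'.
  - by rewrite Sx' in Sy.
move=> _ /mapP [[x y] /CS/and4P [/= Sx Sy xV /andP [yV exy]] ->]; rewrite /f.
case: ifP => //= /negbT F1; apply: contraNT Sy => F2.
rewrite -[y]/(val [` yV]) SE; apply: connect_trans (_ : connect r [` uV] [` xV]) _.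
  by rewrite -SE.
by apply: connect1; rewrite /= exy F1.
Qed.

(** Removing fewer than [d] edges cannot destroy a cut, while removing the [d] edges at a vertex of
    minimal degree isolates it. *)
Lemma edge_connectivity_of_cuts d : is_min_degree V E d ->
  (forall (S : pred T) u v, u \in V -> S u -> v \in V -> ~~ S v ->
     exists2 C, crossing (fun x y => [&& x \in V, y \in V & e x y]) S C & (d <= size C)%N) ->
  is_edge_connectivity V E d.
Proof.
move=> dmin cuts; have [[u [uV ud]] _] := dmin; have dE := has_degreeE ud.
have [V1|V1] := leqP #|` V| 1; [right | left].
  (* With a single vertex, irreflexivity forces degree 0, the conventional edge-connectivity. *)
  split=> //; rewrite dE; apply/eqP; rewrite cardfs_eq0 -fsubset0.
  apply/fsubsetP=> y; rewrite !inE /= => /andP [yV].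
  suff -> : y = u by rewrite eI.
  have/cardfs1P [x xE] : #|` V| == 1 by rewrite eqn_leq V1 cardfs_gt0; apply/fset0Pn; exists u.
  by move: uV yV; rewrite xE !inE => /eqP -> /eqP ->.
split.
  split=> // F Fd; apply: connected_without_of_cuts => S x y xV Sx yV Sy.
  by have [C CS dC] := cuts S x y xV Sx yV Sy; exists C => //; apply: leq_trans dC.
move=> m [_ mconn]; rewrite leqNgt; apply/negP=> dm.
have [v vV vu] : exists2 v, v \in V & v != u.
  have /fset0Pn [v] : V `\ u != fset0.
    by rewrite -cardfs_gt0; move: (cardfsD1 u V); rewrite uV; lia.
  by rewrite !inE => /andP [vu vV]; exists v.
(* Without the star of [u], a walk from [u] to [v] has no first step. *)
pose F := [fset (u, y) | y in nbh u].
have Fd : (#|` F| < m)%N.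
  by apply: leq_ltn_trans dm; rewrite dE; apply: leq_imfset_card.
have [[|y p] /= [pV [pv pw]]] := mconn F Fd u v uV vV; first by rewrite pv eqxx in vu.
have [/eP euy [+ _]] := pw.1; case/negP; apply/imfsetP; exists y => //=.
by rewrite !inE /= euy; case/andP: pV => ->.
Qed.

End EdgeConnectivity.

(** * Coordinates of the columns of A_k *)

Section Coordinates.
Local Open Scope ring_scope.
Variable k : nat.
Local Notation slot := ((bool * 'I_k * bool) + bool)%type.
Implicit Types (j : bool * 'I_k) (s t : bool) (u v w : 'cV[int]_((4 * k).+2)).

(** With booleans for the half and for the block within it, exchanging halves or blocks becomes a
    negation. *)
Definition col_nat (x : slot) : nat :=
  match x with
  | inl (s, i, t) => (s.*2 + t) * k + i
  | inr s => 4 * k + s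
  end.

Lemma col_nat_lt x : (col_nat x < (4 * k).+2)%N.
Proof. case: x => [[[s i] t]|s] /=; last by case: s; lia.
by have := ltn_ord i; case: s; case: t => /=; lia. Qed.

Definition slot_col (x : slot) : 'I_((4 * k).+2) := Ordinal (col_nat_lt x).

Lemma slot_col_inj : injective slot_col.
Proof.
move=> x y /(congr1 val) /=; case: x => [[[s i] t]|s]; case: y => [[[s' i'] t']|s'] /=.
- have := ltn_ord i; have := ltn_ord i' => lti' lti eq.
  have [-> ->] : s = s' /\ t = t' by case: s s' t t' eq => -[] [] [] /=; split=> //; lia.
  by congr (inl (_, _, _)); apply: val_inj => /=; move: eq; case: s' t' => -[] /=; lia.
- by have := ltn_ord i; case: s t s' => -[] [] /=; lia.
- by have := ltn_ord i'; case: s s' t' => -[] [] /=; lia.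
- by case: s s' => -[] //=; lia.
Qed.

(** An injection between finite types of the same size 4k + 2 is onto. *)
Lemma slot_col_surj c : exists x, c = slot_col x.
Proof.
have /inj_card_bij : injective slot_col := slot_col_inj.
rewrite card_sum !card_prod card_bool !card_ord => -[|g _ gK]; first by lia.
by exists (g c); rewrite gK.
Qed.

(** The default [inr false] is never reached, as [slot_col] is onto. *)
Definition col_slot c : slot := odflt (inr false) [pick x | slot_col x == c].

Lemma slot_colK : cancel slot_col col_slot.
Proof.
move=> x; rewrite /col_slot; case: pickP => [y /eqP /slot_col_inj //|/(_ x)].
by rewrite eqxx.
Qed.

(* [pcoord u (s, i) t] is the entry of u in column i of the block number 2s + t of A_k, and
   [lcoord u s] its entry in the single column number s. *)
Definition pcoord u j t : int := u (slot_col (inl (j, t))) 0.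
Definition lcoord u s : int := u (slot_col (inr s)) 0.
Definition vec (p : bool * 'I_k -> bool -> int) (l : bool -> int) : 'cV[int]_((4 * k).+2) :=
  \col_c match col_slot c with inl (j, t) => p j t | inr s => l s end.

Lemma pcoord_vec p l j t : pcoord (vec p l) j t = p j t.
Proof. by rewrite /pcoord mxE slot_colK. Qed.

Lemma lcoord_vec p l s : lcoord (vec p l) s = l s.
Proof. by rewrite /lcoord mxE slot_colK. Qed.

Lemma pcoordD u v j t : pcoord (u + v) j t = pcoord u j t + pcoord v j t.
Proof. exact: mxE. Qed.

Lemma lcoordD u v s : lcoord (u + v) s = lcoord u s + lcoord v s.
Proof. exact: mxE. Qed.

Lemma pcoordN u j t : pcoord (- u) j t = - pcoord u j t.
Proof. exact: mxE. Qed.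

Lemma lcoordN u s : lcoord (- u) s = - lcoord u s.
Proof. exact: mxE. Qed.

Lemma pcoord0 j t : pcoord 0 j t = 0.
Proof. exact: mxE. Qed.

Lemma lcoord0 s : lcoord 0 s = 0.
Proof. exact: mxE. Qed.

Definition coordE := (pcoordD, lcoordD, pcoordN, lcoordN, pcoord_vec, lcoord_vec, pcoord0, lcoord0).

Lemma forall_slot (Q : 'I_((4 * k).+2) -> Prop) :
  (forall j t, Q (slot_col (inl (j, t)))) -> (forall s, Q (slot_col (inr s))) -> forall c, Q c.
Proof. by move=> Qp Ql c; have [[[j t]|s] ->] := slot_col_surj c. Qed.

Lemma coord_ext u v : (forall j t, pcoord u j t = pcoord v j t) ->
  (forall s, lcoord u s = lcoord v s) -> u = v.
Proof.
by move=> up ul; apply/matrixP=> c c'; rewrite ord1; move: c {c'}; exact: forall_slot.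
Qed.

Lemma pair_row_lt j : (j.1 * k + j.2 < (2 * k).+1)%N.
Proof. by case: j => [[] i] /=; have := ltn_ord i; lia. Qed.

Lemma mulA_pair u j : (A_k k *m u) (Ordinal (pair_row_lt j)) 0 =
  pcoord u j false + pcoord u j true - lcoord u j.1.
Proof.
(* The row is a signed sum of three indicators of columns, so the sum over columns collapses. *)
rewrite mxE (eq_bigr (fun c => (c == slot_col (inl (j, false)))%:R * u c 0 +
  (c == slot_col (inl (j, true)))%:R * u c 0 - (c == slot_col (inr j.1))%:R * u c 0)).
  by rewrite !big_split /= sumrN; congr (_ + _ - _);
    under eq_bigr do rewrite mulr_natl mulrb; rewrite -big_mkcond big_pred1_eq.
move=> c _; rewrite mxE -mulrDl -mulrBl; congr (_ * _).
rewrite -!(inj_eq val_inj) /= /Ak_entry.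
by case: j => [[] i] /=; have := ltn_ord i; move: (val c) => {}c ltik; repeat case: ifP; lia.
Qed.

Lemma mulA_last u : (A_k k *m u) ord_max 0 = lcoord u false + lcoord u true.
Proof.
rewrite mxE (eq_bigr (fun c => (c == slot_col (inr false))%:R * u c 0 +
  (c == slot_col (inr true))%:R * u c 0)).
  by rewrite !big_split /=; congr (_ + _);
    under eq_bigr do rewrite mulr_natl mulrb; rewrite -big_mkcond big_pred1_eq.
move=> c _; rewrite mxE -mulrDl; congr (_ * _).
rewrite -!(inj_eq val_inj) /= /Ak_entry.
by move: (val c) => {}c; repeat case: ifP; lia.
Qed.

Lemma mulA_eq0 u : A_k k *m u = 0 <->
  (forall j, pcoord u j false + pcoord u j true = lcoord u j.1) /\
  lcoord u false + lcoord u true = 0.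
Proof.
split=> [Au|[Hp Hl]].
  split=> [j|]; last by rewrite -mulA_last Au mxE.
  by apply/eqP; rewrite -subr_eq0 -mulA_pair Au mxE.
apply/matrixP=> r c; rewrite ord1 [RHS]mxE {c}.
have [r2|] := ltnP r (2 * k); last first.
  move=> r2; rewrite -[RHS]Hl -mulA_last; congr (_ _ _).
  by apply: val_inj => /=; have := ltn_ord r; lia.
(* A row below 2k belongs to the pair whose half is [k <= r] and whose index is [r] reduced by [k]
   in the second half. *)
have ltq : (r - (k <= r) * k < k)%N by case: leqP => /=; lia.
pose j := ((k <= r)%N, Ordinal ltq).
rewrite (_ : r = Ordinal (pair_row_lt j)) ?mulA_pair ?Hp ?subrr //.
by apply: val_inj => /=; case: leqP => /=; lia.
Qed.

(** * The Graver basis *)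

Definition grid_move j t :=
  vec (fun j' t' => if j' == j then (if t' == t then 1 else -1) else 0) (fun _ => 0).

Definition level_move s (g : {ffun bool * 'I_k -> bool}) :=
  vec (fun j t => if t == g j then (if j.1 == s then 1 else -1) else 0)
      (fun s' => if s' == s then 1 else -1).

Lemma grid_move_ker j t : A_k k *m grid_move j t = 0.
Proof.
apply/mulA_eq0; split=> [j'|]; rewrite !coordE //.
by case: eqP => // _; case: t.
Qed.

Lemma level_move_ker s g : A_k k *m level_move s g = 0.
Proof.
apply/mulA_eq0; split=> [j|]; rewrite !coordE; last by case: s.
by case: (g j); rewrite /= ?add0r ?addr0.
Qed.

Lemma grid_moveN j t : - grid_move j t = grid_move j (~~ t).
Proof.
apply: coord_ext => [j' t'|s]; rewrite !coordE ?oppr0 //.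
by case: eqP => // _; case: t t' => -[]; rewrite /= ?opprK.
Qed.

Lemma level_moveN s g : - level_move s g = level_move (~~ s) g.
Proof.
apply: coord_ext => [j t|s']; rewrite !coordE.
  by case: (t == g j) => //; case: j.1 s => -[]; rewrite /= ?opprK.
by case: s s' => -[]; rewrite /= ?opprK.
Qed.

Lemma grid_move_inj j t j' t' : grid_move j t = grid_move j' t' -> j = j' /\ t = t'.
Proof.
move=> /(congr1 (fun u => pcoord u j t)); rewrite !coordE !eqxx.
by case: eqP => // -> ; case: eqP.
Qed.

Lemma level_move_inj s g s' g' : level_move s g = level_move s' g' -> s = s' /\ g = g'.
Proof.
move=> eq; have ss : s = s'.
  by move: (congr1 (lcoord^~ s) eq); rewrite !coordE eqxx; case: eqP.
split=> //; apply/ffunP=> j; move: (congr1 (fun u => pcoord u j (g j)) eq).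
by rewrite !coordE eqxx; case: (g j =P g' j) => // _; case: ifP.
Qed.

Lemma conf_leP u v : conf_le u v <->
  (forall j t, 0 <= pcoord u j t * pcoord v j t /\ `|pcoord u j t| <= `|pcoord v j t|) /\
  (forall s, 0 <= lcoord u s * lcoord v s /\ `|lcoord u s| <= `|lcoord v s|).
Proof.
split=> [uv|[cp cl] c]; first by split=> [j t|s]; exact: (uv (slot_col _)).
by have [[[j t]|s] ->] := slot_col_surj c; [exact: cp | exact: cl].
Qed.

(** A kernel element conformally below the move has zero levels and lives on the pair [j], where its
    two entries are opposite; so it is zero or the move itself. *)
Lemma graver_grid_move j t : graver (A_k k) (grid_move j t).
Proof.
split; first exact: grid_move_ker.
split=> [/(congr1 (fun u => pcoord u j t))|w /mulA_eq0 [wp wl] w0 /conf_leP [cp cl]].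
  by rewrite !coordE !eqxx.
have lw s : lcoord w s = 0 by have [_] := cl s; rewrite coordE; lia.
have ow j' : j' != j -> forall t', pcoord w j' t' = 0.
  by move=> /negbTE jj t'; have [_] := cp j' t'; rewrite coordE jj; lia.
have jw : pcoord w j (~~ t) = - pcoord w j t by have := wp j; rewrite lw; case: (t) => /=; lia.
have [j1|jn1] := eqVneq (pcoord w j t) 1.
  apply: coord_ext => [j' t'|s]; rewrite !coordE //.
  case: eqVneq => [->|/ow //]; case: eqVneq => [->//|].
  by rewrite -j1 -jw; case: (t) t' => -[].
case: w0; have j0 : pcoord w j t = 0.
  by have [] := cp j t; rewrite coordE !eqxx; move: jn1; lia.
apply: coord_ext => [j' t'|s]; rewrite !coordE //.
case: (eqVneq j' j) => [->|/ow //]; have [->//|] := eqVneq t' t.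
by move: jw; rewrite j0 oppr0; case: (t) t' => -[].
Qed.

(** A kernel element [w] conformally below the move vanishes off the entries selected by [g], so
    each selected entry equals the level of its half. Thus [w] is determined by [lcoord w s], which
    is 0 or 1. *)
Lemma graver_level_move s g : graver (A_k k) (level_move s g).
Proof.
split; first exact: level_move_ker.
split=> [/(congr1 (lcoord^~ s))|w /mulA_eq0 [wp wl] w0 /conf_leP [cp cl]].
  by rewrite !coordE eqxx.
have pw0 j : pcoord w j (~~ g j) = 0.
  by have [_] := cp j (~~ g j); rewrite coordE; case: eqP; [case: (g j) | lia].
have pw j : pcoord w j (g j) = lcoord w j.1.
  by have := pw0 j; have := wp j; case: (g j) => /=; lia.
have lw : lcoord w (~~ s) = - lcoord w s by case: (s) wl => /=; lia.
have lws : lcoord w s = 0 \/ lcoord w s = 1 by have := cl s; rewrite coordE eqxx; lia.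
have pE j t : pcoord w j t = if t == g j then lcoord w j.1 else 0.
  by case: eqP => [->//|]; have := pw0 j; case: (g j) t => -[].
have lE s' : lcoord w s' = if s' == s then lcoord w s else - lcoord w s.
  by rewrite -lw; case: (s) s' => -[].
case: lws => l1; last first.
  by apply: coord_ext => [j t|s']; rewrite !coordE ?pE lE l1.
by case: w0; apply: coord_ext => [j t|s']; rewrite ?pE lE l1 !coordE oppr0 !if_same.
Qed.

(** A kernel element with entries of opposite signs in some pair lies above a grid move. Otherwise
    nothing cancels inside the pairs, and a nonzero element lies above a level move. Minimality
    turns either comparison into an equality. *)
Lemma graverP v : graver (A_k k) v <->
  (exists j t, v = grid_move j t) \/ (exists s g, v = level_move s g).
Proof.
split; last first.
  by case=> [[j [t ->]]|[s [g ->]]]; [exact: graver_grid_move | exact: graver_level_move].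
move=> [/mulA_eq0 [vp vl] [v0 vmin]].
have grid_nz j t : grid_move j t <> 0.
  by move=> /(congr1 (fun u => pcoord u j t)); rewrite !coordE !eqxx.
have level_nz s g : level_move s g <> 0.
  by move=> /(congr1 (lcoord^~ s)); rewrite !coordE eqxx.
have [[j vj]|same] : (exists j, pcoord v j false * pcoord v j true < 0) \/
    forall j, 0 <= pcoord v j false * pcoord v j true.
  have [/existsP [j vj]|] := boolP [exists j, pcoord v j false * pcoord v j true < 0].
    by left; exists j.
  by rewrite negb_exists => /forallP vj; right=> j; rewrite leNgt vj.
  have [t [jt jnt]] : exists t, 0 < pcoord v j t /\ pcoord v j (~~ t) < 0.
    have [v0p|v0n|v0z] := ltrgtP (pcoord v j false) 0; last by move: vj; rewrite v0z mul0r ltxx.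
      by exists true; move: vj; rewrite nmulr_rlt0.
    by exists false; move: vj; rewrite pmulr_rlt0.
  left; exists j, t; apply/esym/vmin => //; first exact: grid_move_ker.
  apply/conf_leP; split=> [j' t'|s]; rewrite !coordE; last by rewrite mul0r normr0.
  case: eqP => [->|_]; last by rewrite mul0r normr0.
  by case: eqVneq => [->|]; [lia | move: jnt; case: (t) t' => -[] //=; lia].
have [s ls] : exists s, 0 < lcoord v s.
  have [l0|l0|l0] := ltrgtP (lcoord v false) 0; [by exists true; lia | by exists false |].
  (* If both levels vanish, each pair sums to zero without opposite signs, hence is zero. *)
  case: v0; have lz s : lcoord v s = 0 by case: s; lia.
  apply: coord_ext => [j t|s]; rewrite !coordE //.
  by have := same j; have := vp j; rewrite lz; case: t; nia.
(* In each pair, [g] selects an entry having the sign of the level of its half. *)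
pose g := [ffun j : bool * 'I_k =>
  if j.1 == s then 0 < pcoord v j true else pcoord v j true < 0].
right; exists s, g; apply/esym/vmin => //; first exact: level_move_ker.
have lns : lcoord v (~~ s) = - lcoord v s by case: (s) vl => /=; lia.
apply/conf_leP; split=> [j t|s']; rewrite !coordE; last first.
  have [->|] := eqVneq s' s; first by lia.
  by move: ls lns; case: (s) s' => -[] //=; lia.
rewrite ffunE; have := same j; have := vp j.
have [js|js] := eqVneq j.1 s.
  by rewrite js; case: t; case: (ltrP 0 (pcoord v j true)) => /=; nia.
have -> : j.1 = ~~ s by move: js; case: (s) (j.1) => -[].
by rewrite lns; case: t; case: (ltrP (pcoord v j true) 0) => /=; nia.
Qed.

(** * Adjacency in the Graver fiber graph *)

Definition adj : rel 'cV[int]_((4 * k).+2) := fun u v =>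
  [exists j, exists t, v == u + grid_move j t] || [exists s, exists g, v == u + level_move s g].

Lemma adjP u v : reflect
  ((exists j t, v = u + grid_move j t) \/ (exists s g, v = u + level_move s g)) (adj u v).
Proof.
apply: (iffP orP) => -[].
- by case/existsP=> j /existsP [t /eqP ->]; left; exists j, t.
- by case/existsP=> s /existsP [g /eqP ->]; right; exists s, g.
- by case=> j [t ->]; left; apply/existsP; exists j; apply/existsP; exists t.
- by case=> s [g ->]; right; apply/existsP; exists s; apply/existsP; exists g.
Qed.

(** The Graver basis is closed under negation, so the two orientations in [fiber_adj] agree. The
    moves form a finite family, which makes [adj] boolean. *)
Lemma fiber_adjP u v : fiber_adj (graver (A_k k)) u v <-> adj u v.
Proof.
have graverN w : graver (A_k k) (- w) -> graver (A_k k) w.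
  move=> /graverP [[j [t eq]]|[s [g eq]]]; apply/graverP; rewrite -[w]opprK eq.
    by left; exists j, (~~ t); rewrite grid_moveN.
  by right; exists (~~ s), g; rewrite level_moveN.
split=> [[_ uv]|/adjP vu].
  have /graverP gvu : graver (A_k k) (v - u) by case: uv => //; rewrite -opprB; exact: graverN.
  apply/adjP; case: gvu => [[j [t eq]]|[s [g eq]]]; [left | right].
    by exists j, t; rewrite -eq addrC subrK.
  by exists s, g; rewrite -eq addrC subrK.
have gvu : graver (A_k k) (v - u).
  apply/graverP; case: vu => [[j [t ->]]|[s [g ->]]]; [left | right].
    by exists j, t; rewrite addrC addKr.
  by exists s, g; rewrite addrC addKr.
split; last by right.
by move=> uv; case: gvu => _ []; rewrite uv subrr.
Qed.

Lemma adj_irrefl : irreflexive adj.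
Proof. by move=> u; apply/negP=> /fiber_adjP []. Qed.

(** * Cuts of the fiber graph *)

Section Fiber.
Variables (b : 'cV[int]_((2 * k).+1)).
Local Notation fiber := (in_fiber (A_k k) b).

(** A known point [w] of the fiber stands in for [b], which reduces membership to the kernel
    equations of [mulA_eq0]. *)
Lemma fiberP u w : fiber w -> fiber u <->
  [/\ forall j t, 0 <= pcoord u j t, forall s, 0 <= lcoord u s & A_k k *m (u - w) = 0].
Proof.
move=> [_ Aw].
have AuE : A_k k *m (u - w) = 0 <-> A_k k *m u = b.
  rewrite mulmxBr Aw; split=> [/eqP|Au]; last by apply/eqP; rewrite subr_eq0; apply/eqP.
  by rewrite subr_eq0 => /eqP.
split=> [[u0 /AuE Au]|[up ul /AuE Au]]; first by split=> // *; exact: u0.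
by split=> //; exact: forall_slot.
Qed.

Lemma fiber_ge0 u j t : fiber u -> 0 <= pcoord u j t.
Proof. by case=> u0 _; exact: u0. Qed.

Lemma fiber_lge0 u s : fiber u -> 0 <= lcoord u s.
Proof. by case=> u0 _; exact: u0. Qed.

(** Both sides are the entry of [b] in the row of the pair [j]; [t] and [t'] only fix the order of
    the summands. *)
Lemma fiber_pair u v j t t' : fiber u -> fiber v ->
  pcoord u j t + pcoord u j (~~ t) - lcoord u j.1 =
  pcoord v j t' + pcoord v j (~~ t') - lcoord v j.1.
Proof.
move=> fu /(fiberP _ fu) [_ _ /mulA_eq0 [/(_ j)]]; rewrite !coordE.
by case: t t' => -[] /=; lia.
Qed.

Lemma fiber_levels u v s s' : fiber u -> fiber v ->
  lcoord u s + lcoord u (~~ s) = lcoord v s' + lcoord v (~~ s').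
Proof.
move=> fu /(fiberP _ fu) [_ _ /mulA_eq0 [_]]; rewrite !coordE.
by case: s s' => -[] /=; lia.
Qed.

Lemma fiber_grid_move u j t : fiber u -> 0 < pcoord u j (~~ t) -> fiber (u + grid_move j t).
Proof.
move=> fu ut; apply/(fiberP _ fu).
split; [move=> j' t'|move=> s|by rewrite addrC addKr grid_move_ker].
  have := fiber_ge0 j' t' fu; rewrite !coordE; case: eqP => [->|_]; last by rewrite addr0.
  by case: eqVneq; [lia | move: ut; case: (t) t' => -[] //=; lia].
by rewrite !coordE addr0 fiber_lge0.
Qed.

Lemma fiber_level_move u s (g : {ffun bool * 'I_k -> bool}) : fiber u -> 0 < lcoord u (~~ s) ->
  (forall i, 0 < pcoord u (~~ s, i) (g (~~ s, i))) -> fiber (u + level_move s g).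
Proof.
move=> fu us gs; apply/(fiberP _ fu).
split; [move=> j t|move=> s'|by rewrite addrC addKr level_move_ker]; rewrite !coordE.
  have := fiber_ge0 j t fu; case: eqP => [->|_]; last by rewrite addr0.
  case: eqVneq => [js|js]; first by lia.
  have -> : j = (~~ s, j.2) by case: j js => [s' i] /=; case: s s' {us gs} => -[].
  by have := gs j.2; lia.
have := fiber_lge0 s' fu; case: eqVneq => [|ss]; first by lia.
by have -> : s' = ~~ s; [case: s s' ss {us gs} => -[] | move: us; lia].
Qed.

Variable V : {fset 'cV[int]_((4 * k).+2)}.
Hypothesis VP : forall u, u \in V <-> fiber u.

Lemma lcoord_grid_move u j t s : lcoord (u + grid_move j t) s = lcoord u s.
Proof. by rewrite !coordE addr0. Qed.

Lemma lcoord_level_move u s g : lcoord (u + level_move s g) s = lcoord u s + 1.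
Proof. by rewrite !coordE eqxx. Qed.

(** Walk from [u] to [v] by grid moves that each bring one pair closer to [v]; the walk has to leave
    [S] at some step. *)
Lemma grid_edge_of_split (S : pred 'cV[int]_((4 * k).+2)) u v :
  u \in V -> v \in V -> (forall s, lcoord u s = lcoord v s) -> S u -> ~~ S v ->
  exists x j t, [/\ x \in V, x + grid_move j t \in V, S x & ~~ S (x + grid_move j t)].
Proof.
(* Measuring the [true] entries suffices: at equal levels the pair sums agree, so the [false]
   entries follow. *)
move=> uV vV; pose dist x := (\sum_j `|(pcoord x j true - pcoord v j true)%R|)%N.
have [n] := ubnP (dist u); elim: n u uV => // n IH u uV dn uvL Su Sv.
have fu := (VP u).1 uV; have fv := (VP v).1 vV.
have uvp j t : pcoord u j t + pcoord u j (~~ t) = pcoord v j t + pcoord v j (~~ t).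
  by have := fiber_pair j t t fu fv; rewrite uvL => /addIr.
have [j [t ltt]] : exists j t, pcoord u j t < pcoord v j t.
  have [/existsP [j /existsP [t uvt]]|] :=
      boolP [exists j, exists t, pcoord u j t < pcoord v j t].
    by exists j, t.
  rewrite negb_exists => /forallP nlt; case/negP: Sv; suff <- : u = v by [].
  apply: coord_ext => // j t; have := uvp j t.
  have := nlt j; rewrite negb_exists => /forallP nltj.
  have := nltj t; have := nltj (~~ t); set p := pcoord u j t; set p' := pcoord u j (~~ t).
  by set q := pcoord v j t; set q' := pcoord v j (~~ t); lia.
have ut : 0 < pcoord u j (~~ t).
  by have := uvp j t; have := fiber_ge0 j (~~ t) fv; move: ltt; lia.
have xV : u + grid_move j t \in V by apply/VP/fiber_grid_move.
have [Sx|Sx] := boolP (S (u + grid_move j t)); last by exists u, j, t.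
apply: (IH (u + grid_move j t)) => // [|s]; last by rewrite lcoord_grid_move.
rewrite ltnS in dn; apply: leq_trans dn; rewrite /dist (bigD1 j) //= [ltnRHS](bigD1 j) //=.
rewrite -addSn; apply: leq_add; last first.
  by apply: eq_leq; apply: eq_bigr => j' /negbTE jj'; rewrite !coordE jj' addr0.
by rewrite !coordE eqxx; have := uvp j t; case: (t) ltt => /=; lia.
Qed.

(** On the half [~~ s], the level and all pair sums of [u] exceed those of [w], which are
    nonnegative. This is what a level move at [u] requires. *)
Lemma level_gt0 u w s : u \in V -> w \in V -> lcoord u s < lcoord w s ->
  0 < lcoord u (~~ s) /\ forall i, 0 < pcoord u (~~ s, i) false + pcoord u (~~ s, i) true.
Proof.
move=> /VP fu /VP fw us; have := fiber_levels s s fu fw; have := fiber_lge0 (~~ s) fw.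
split=> [|i]; first lia.
have := fiber_pair (~~ s, i) false false fu fw.
by have := fiber_ge0 (~~ s, i) false fw; have := fiber_ge0 (~~ s, i) true fw => /=; lia.
Qed.

(** The half [s] gains units, so [a] is free there and accounts for the factor [2 ^ k]; the other
    half loses units, and [d] must point to positive entries. *)
Definition choice s (a : {ffun 'I_k -> bool}) (d : bool * 'I_k -> bool) :=
  [ffun j : bool * 'I_k => if j.1 == s then a j.2 else d j].

Lemma choice_inj s a a' d d' : choice s a d = choice s a' d' -> a = a'.
Proof.
by move=> aa'; apply/ffunP=> i; move/ffunP/(_ (s, i)): aa'; rewrite !ffunE eqxx.
Qed.

Lemma choice_move u w s a d : u \in V -> w \in V -> lcoord u s < lcoord w s ->
  (forall i, 0 < pcoord u (~~ s, i) (d (~~ s, i))) -> u + level_move s (choice s a d) \in V.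
Proof.
move=> uV wV uw du; apply/VP/fiber_level_move; first exact/VP.
  by have [] := level_gt0 uV wV uw.
by move=> i; rewrite ffunE; case: s {uw} du => /=.
Qed.

(** Also used as an index: it names a positive entry of the pair whenever the pair sum is
    positive. *)
Definition pos u j := 0 < pcoord u j true.

Lemma posP u j : u \in V -> 0 < pcoord u j false + pcoord u j true -> 0 < pcoord u j (pos u j).
Proof.
move=> /VP fu; rewrite /pos; case: (ltrP 0 (pcoord u j true)) => //.
by have := fiber_ge0 j true fu; lia.
Qed.

(** Climb from [u] by level moves towards the level of [v]. Either the climb leaves [S], or it
    reaches that level inside [S] and grid moves finish the walk. *)
Lemma crossing_edge (S : pred 'cV[int]_((4 * k).+2)) u v : u \in V -> v \in V -> S u -> ~~ S v ->
  (exists x j t, [/\ x \in V, x + grid_move j t \in V, S x & ~~ S (x + grid_move j t)]) \/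
  (exists x s g, [/\ x \in V, x + level_move s g \in V, S x & ~~ S (x + level_move s g)]).
Proof.
move=> uV vV Su Sv; have fu := (VP u).1 uV; have fv := (VP v).1 vV.
have [s us] : exists s, lcoord u s <= lcoord v s.
  have [uv|uv] := lerP (lcoord u false) (lcoord v false); first by exists false.
  by exists true; have /= := fiber_levels false false fu fv; lia.
have [n] := ubnP `|lcoord v s - lcoord u s|%N; elim: n u uV fu us Su => // n IH u uV fu us Su dn.
have [uv|uv] := eqVneq (lcoord u s) (lcoord v s).
  left; apply: (grid_edge_of_split uV vV) => // s'.
  by have := fiber_levels s s fu fv; rewrite uv => /addrI; case: (s) s' uv => -[].
have {}us : lcoord u s < lcoord v s by rewrite lt_neqAle uv.
have xV : u + level_move s (choice s [ffun=> true] (pos u)) \in V.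
  apply: (choice_move _ uV vV us) => i; apply: posP => //.
  by have [_] := level_gt0 uV vV us; exact.
have [Sx|Sx] := boolP (S (u + level_move s (choice s [ffun=> true] (pos u)))); last first.
  by right; exists u, s, (choice s [ffun=> true] (pos u)).
by apply: (IH _ xV) => //; [exact/VP | |]; rewrite lcoord_level_move; lia.
Qed.

(** The set D(u): the pairs on which some grid move is possible at [u]. *)
Definition nondeg u := [pred j | 0 < pcoord u j false + pcoord u j true].

Lemma adj_sym : symmetric adj.
Proof.
suff sub u v : adj u v -> adj v u by move=> u v; apply/idP/idP; exact: sub.
case/adjP=> [[j [t ->]]|[s [g ->]]]; apply/adjP; [left | right].
  by exists j, (~~ t); rewrite -grid_moveN addrK.
by exists (~~ s), g; rewrite -level_moveN addrK.
Qed.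

Lemma adj_grid_move u j t : adj u (u + grid_move j t).
Proof. by apply/adjP; left; exists j, t. Qed.

Lemma adj_level_move u s g : adj u (u + level_move s g).
Proof. by apply/adjP; right; exists s, g. Qed.

Definition fiber_edge u v := [&& u \in V, v \in V & adj u v].

(** The constant predicate [c] empties the type when there is a single level, so both cases share
    one index type. *)
Lemma card_ffun_if (c : bool) : #|{: {a : {ffun 'I_k -> bool} | c}}| = (c * 2 ^ k)%N.
Proof.
rewrite card_sig; case: c; last by rewrite eq_card0.
by rewrite mul1n -[in RHS](card_ord k) -card_bool -card_ffun; apply: eq_card.
Qed.

(* When the grid move acts on a pair that loses a unit along the level moves, d and d' make
   u and v meet in a common neighbour; in all other cases the edge u -> v is translated. *)
Lemma grid_edge_paths (c : bool) s u j0 t0 : u \in V -> u + grid_move j0 t0 \in V ->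
  (c -> exists2 w, w \in V & lcoord u s < lcoord w s) ->
  forall S : pred 'cV[int]_((4 * k).+2), S u -> ~~ S (u + grid_move j0 t0) ->
  exists2 C, crossing fiber_edge S C & size C = (#|nondeg u| + c * 2 ^ k)%N.
Proof.
set v := u + _ => uV vV cw S Su Sv.
pose d j := if j == j0 then ~~ t0 else pos u j.
pose d' j := if j == j0 then t0 else pos u j.
(* [I] indexes the paths other than the edge from [u] to [v] itself; that edge makes up for the
   excluded pair [j0] in the count. *)
pose I := ({j | (j \in nondeg u) && (j != j0)} + {a : {ffun 'I_k -> bool} | c})%type.
pose move (d : bool * 'I_k -> bool) (x : I) := match x with
  | inl j => grid_move (val j) (~~ pos u (val j))
  | inr a => level_move s (choice s (val a) d) end.
have jt0 : 0 < pcoord u j0 (~~ t0).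
  have /VP/(fiber_ge0 j0 (~~ t0)) := vV; rewrite !coordE eqxx.
  by case: (t0) => /=; lia.
have vE j t : j != j0 -> pcoord v j t = pcoord u j t by move=> /negbTE jj; rewrite !coordE jj addr0.
have vL s' : lcoord v s' = lcoord u s' by exact: lcoord_grid_move.
have move_inj e : injective (move e).
  move=> [j|a] [j'|a'] /=.
  - by case/grid_move_inj=> /val_inj -> .
  - by move/(congr1 (lcoord^~ s)); rewrite !coordE eqxx.
  - by move/(congr1 (lcoord^~ s)); rewrite !coordE eqxx.
  - by case/level_move_inj=> _ /choice_inj /val_inj ->.
have nzr (x m : 'cV[int]_((4 * k).+2)) : m <> 0 -> x + m != x.
  by move=> /eqP m0; rewrite -subr_eq0 addrC addKr.
have gnz j t : grid_move j t <> 0.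
  by move=> /(congr1 (fun w => pcoord w j t)); rewrite !coordE !eqxx.
have aV x : u + move d x \in V.
  case: x => [[j /= /andP [jn jj]]|[a /= /cw [w wV uw]]].
    by apply/VP/fiber_grid_move; [exact/VP | rewrite negbK posP].
  apply: (choice_move _ uV wV uw) => i; rewrite /d; case: eqP => [->//|_].
  by apply: posP => //; have [_] := level_gt0 uV wV uw; exact.
have bV x : v + move d' x \in V.
  case: x => [[j /= /andP [jn jj]]|[a /= /cw [w wV uw]]].
    by apply/VP/fiber_grid_move; [exact/VP | rewrite negbK vE ?posP].
  apply: (choice_move _ vV wV); rewrite ?vL // => i; rewrite /d'; case: eqVneq => [->|jj].
    by rewrite !coordE !eqxx; have /VP/(fiber_ge0 j0 t0) := uV; lia.
  by rewrite vE //; apply: posP => //; have [_] := level_gt0 uV wV uw; exact.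
have [|||x|x|C CS CI] := @crossing_of_paths _ fiber_edge S I
  (fun x => u + move d x) (fun x => v + move d' x) u v Su Sv.
- by rewrite /fiber_edge uV vV adj_grid_move.
- by move=> x y /addrI /move_inj.
- by move=> x y /addrI /move_inj.
- case: x => [[j /= /andP [jn /eqP jj]]|a] /=; last first.
    have neL y z : lcoord y s = lcoord z s + 1 -> y != z.
      by move=> yz; apply: contra_eq_neq yz => ->; apply/eqP; lia.
    by split; apply: neL; rewrite lcoord_level_move ?vL.
  split; [by apply: nzr | by apply/eqP=> /addrI /grid_move_inj [] | | by apply: nzr].
  by rewrite -addrA; apply: nzr => /eqP;
    rewrite addr_eq0 grid_moveN => /eqP /grid_move_inj [/esym/jj].
- split; rewrite /fiber_edge ?uV ?vV ?aV ?bV /=.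
  + by case: x {aV bV} => *; [exact: adj_grid_move | exact: adj_level_move].
  + case: x {aV bV} => [j|a] /= ab.
      by rewrite /v addrAC adj_grid_move.
    have [js|js] := eqVneq j0.1 s.
      have -> : choice s (val a) d' = choice s (val a) d.
        apply/ffunP=> j; rewrite !ffunE /d /d'; case: (eqVneq j j0) => [->|//].
        by rewrite js eqxx.
      by rewrite /v addrAC adj_grid_move.
    case/eqP: ab; rewrite /v -addrA; congr (u + _).
    apply: coord_ext => [j t|s']; rewrite !coordE ?add0r // !ffunE.
    rewrite /d /d'; case: (eqVneq j j0) => [->|_]; last by rewrite add0r.
    by rewrite (negbTE js); case: (t0) t => -[].
  + by rewrite adj_sym; case: x {aV bV} => *; [exact: adj_grid_move | exact: adj_level_move].
- exists C => //; rewrite CI card_sum card_ffun_if -addSn; congr (_ + _)%N.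
  rewrite card_sig (cardD1 j0 (nondeg u)) inE.
  have -> : 0 < pcoord u j0 false + pcoord u j0 true.
    by have /VP/(fiber_ge0 j0 t0) := uV; case: (t0) jt0 => /=; lia.
  by congr _.+1; apply: eq_card => j; rewrite !inE andbC.
Qed.

(** All edges from the level of [u] to the next one are cut. The list takes [2 ^ k] of them at [u]
    and one at a grid neighbour of [u] for each pair in D(u). *)
Lemma level_edges s u w : u \in V -> w \in V -> lcoord u s < lcoord w s ->
  forall S : pred 'cV[int]_((4 * k).+2),
  (forall x, x \in V -> lcoord x s = lcoord u s -> S x) ->
  (forall y, y \in V -> lcoord y s = lcoord u s + 1 -> ~~ S y) ->
  exists2 C, crossing fiber_edge S C & size C = (#|nondeg u| + true * 2 ^ k)%N.
Proof.
move=> uV wV uw S Su Sw.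
pose I := ({j | j \in nondeg u} + {a : {ffun 'I_k -> bool} | true})%type.
pose base (x : I) := if x is inl j then u + grid_move (val j) (~~ pos u (val j)) else u.
pose top (x : I) := base x + level_move s
  (choice s (if x is inr a then val a else [ffun=> true]) (pos (base x))).
have gnz j t : u + grid_move j t != u.
  apply/eqP=> /(congr1 (fun w => pcoord w j t)); rewrite !coordE !eqxx.
  by move/eqP; rewrite -subr_eq0 addrC addKr.
have baseV x : base x \in V.
  case: x => [[j jn]|a] //=; apply/VP/fiber_grid_move; first exact/VP.
  by rewrite negbK posP.
have baseL x s' : lcoord (base x) s' = lcoord u s'.
  by case: x => //= j; rewrite lcoord_grid_move.
have topV x : top x \in V.
  have xw : lcoord (base x) s < lcoord w s by rewrite baseL.
  apply: (choice_move _ (baseV x) wV xw) => i; apply: posP => //.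
  by have [_] := level_gt0 (baseV x) wV xw; exact.
exists [seq (base x, top x) | x <- enum {: I}]; last first.
  by rewrite size_map -cardE card_sum card_ffun_if card_sig.
split=> [|_ /mapP [x _ ->]] /=; last first.
  rewrite /fiber_edge baseV topV adj_level_move Su ?Sw ?baseL //.
  by rewrite lcoord_level_move baseL.
rewrite map_inj_uniq ?enum_uniq // => x y [].
case: x => [j|a]; case: y => [j'|a'] //=.
- by move=> /addrI /grid_move_inj [/val_inj ->].
- by move=> /eqP; rewrite (negbTE (gnz _ _)).
- by move=> /esym /eqP; rewrite (negbTE (gnz _ _)).
- by move=> _ /addrI /level_move_inj [_ /choice_inj /val_inj ->].
Qed.

(** * Corners and the minimal degree *)

Definition corner w :=
  vec (fun j t => if t then pcoord w j false + pcoord w j true else 0) (lcoord w).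

Lemma corner_fiber w : w \in V -> corner w \in V.
Proof.
move=> wV; have fw := (VP w).1 wV; apply/VP/(fiberP _ fw); split=> [j t|s|].
- by rewrite coordE; case: t => //; apply: addr_ge0; exact: fiber_ge0 fw.
- by rewrite coordE; exact: fiber_lge0 fw.
- by apply/mulA_eq0; split=> [j|]; rewrite !coordE; lia.
Qed.

Section MinDegree.
Variable d : nat.
Hypothesis dmin : is_min_degree V (fiber_adj (graver (A_k k))) d.

(** At the corner each pair of positive sum allows a single grid move, out of its [true] entry. As
    the level [s] is minimal, level moves can only raise it; losing pairs must use their [true]
    entry, so only the choice on the half [s] is free. *)
Lemma min_degree_corner (c : bool) s w : w \in V ->
  (forall v, v \in V -> lcoord w s <= lcoord v s) ->
  (~~ c -> forall v, v \in V -> lcoord v s = lcoord w s) ->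
  (d <= #|nondeg w| + c * 2 ^ k)%N.
Proof.
move=> wV wmin wc.
pose up a := corner w + level_move s (choice s a (fun=> true)).
rewrite [leqRHS](_ : _ = size ([seq corner w + grid_move j false | j <- enum (nondeg w)] ++
  [seq up (val a) | a <- enum {: {a : {ffun 'I_k -> bool} | c}}])); last first.
  rewrite size_cat !size_map -[size (enum (nondeg w))]cardE; congr (_ + _)%N.
  by rewrite -enumT -cardT card_ffun_if.
apply: (min_degree_le fiber_adjP dmin (corner_fiber wV)) => y yV /adjP wy.
case: wy yV => [[j [t ->]]|[s' [g ->]]] yV; have fy := (VP _).1 yV; rewrite mem_cat; apply/orP.
  left; apply/mapP; have tF : t = false.
    by have := fiber_ge0 j false fy; rewrite !coordE eqxx; case: t {yV fy}.
  exists j; rewrite ?tF // mem_enum inE.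
  by have := fiber_ge0 j true fy; rewrite tF !coordE eqxx /=; lia.
right; have ss : s' = s.
  have := wmin _ yV; rewrite !coordE; case: eqVneq => [->//|]; lia.
rewrite {s'}ss in yV fy *.
have cT : c.
  by apply: contraT => /wc /(_ _ yV); rewrite !coordE eqxx; lia.
apply/mapP; exists (exist _ [ffun i => g (s, i)] cT); first by rewrite mem_enum.
rewrite /up /=; congr (_ + level_move _ _); apply/ffunP=> j; rewrite !ffunE.
case: eqVneq => [<-|js]; first by case: (j).
by have := fiber_ge0 j (g j) fy; rewrite !coordE eqxx (negbTE js); case: (g j).
Qed.

(** Compare [u] with a point [w] where the level [s] is minimal: D(w) is contained in D(u). On the
    half [s] pair sums grow with the level. On the other half all pairs of [u] have positive sum if
    [s] can be raised, and with a single level the sums agree. *)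
Lemma min_degree_bound (c : bool) s u : u \in V ->
  (c -> exists2 w, w \in V & lcoord u s < lcoord w s) ->
  (~~ c -> forall v, v \in V -> lcoord v s = lcoord u s) ->
  (d <= #|nondeg u| + c * 2 ^ k)%N.
Proof.
move=> uV cT cF.
have [w wV wmin] : exists2 w, w \in V & forall v, v \in V -> lcoord w s <= lcoord v s.
  case: (@arg_minP _ _ V [` uV] xpredT (fun x => lcoord (val x) s)) => // x _ xmin.
  by exists (val x) => [|v vV]; [exact: valP | exact: (xmin [` vV])].
apply: leq_trans (min_degree_corner (c := c) wV wmin _) _.
  by move=> /cF cL v vV; rewrite !cL.
rewrite leq_add2r; apply/subset_leq_card/subsetP=> j; rewrite !inE => wj.
have fu := (VP u).1 uV; have fw := (VP w).1 wV.
have := fiber_pair j false false fu fw => /=.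
have [-> |js] := eqVneq j.1 s; first by have := wmin u uV; lia.
have {}js : j.1 = ~~ s by case: (s) (j.1) js => -[].
case: c cT cF => [[] // x xV ux _|_ /(_ isT w wV) ws].
  by have [_ /(_ j.2)] := level_gt0 uV xV ux; rewrite -js -surjective_pairing.
by have := fiber_levels s s fu fw; rewrite js ws; lia.
Qed.

Lemma fiber_cut (S : pred 'cV[int]_((4 * k).+2)) u v : u \in V -> S u -> v \in V -> ~~ S v ->
  exists2 C, crossing fiber_edge S C & (d <= size C)%N.
Proof.
have grid_edge x j t : x \in V -> x + grid_move j t \in V -> S x -> ~~ S (x + grid_move j t) ->
    exists2 C, crossing fiber_edge S C & (d <= size C)%N.
  move=> xV yV Sx Sy; have fx := (VP x).1 xV.
  (* [c] records whether there are several levels; if so, [s] is a direction in which [x] is not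
     extremal. *)
  have [c [s [cT cF]]] : exists (c : bool) s,
      (c -> exists2 w, w \in V & lcoord x s < lcoord w s) /\
      (~~ c -> forall w, w \in V -> lcoord w s = lcoord x s).
    have [/existsP [[w wV] /= xw]|] := boolP [exists w : V, lcoord (val w) false != lcoord x false].
      exists true; have fw := (VP _).1 wV.
      have [xw'|xw'] := ltrP (lcoord x false) (lcoord w false).
        by exists false; split=> // _; exists w.
      exists true; split=> // _; exists w => //.
      by have /= := fiber_levels false false fx fw; lia.
    rewrite negb_exists => /forallP xE; exists false, false; split=> // _ w wV.
    by have := xE [` wV]; rewrite negbK => /eqP.
  have [C CS CI] := grid_edge_paths xV yV cT Sx Sy.
  by exists C => //; rewrite CI; exact: min_degree_bound cF.
have split_level x y s : x \in V -> y \in V -> lcoord x s = lcoord y s -> S x -> ~~ S y ->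
    exists2 C, crossing fiber_edge S C & (d <= size C)%N.
  move=> xV yV xy Sx Sy.
  have xyL s' : lcoord x s' = lcoord y s'.
    have := fiber_levels s s ((VP x).1 xV) ((VP y).1 yV); rewrite xy => /addrI.
    by case: (s) s' xy => -[].
  have [x' [j [t [*]]]] := grid_edge_of_split xV yV xyL Sx Sy.
  exact: (@grid_edge x' j t).
move=> uV Su vV Sv.
have [[x [j [t [*]]]]|[x [s [g [xV yV Sx Sy]]]]] := crossing_edge uV vV Su Sv.
  exact: (@grid_edge x j t).
have yL : lcoord (x + level_move s g) s = lcoord x s + 1 := lcoord_level_move x s g.
(* If one of the two levels joined by this edge is itself split by [S], the grid case applies;
   otherwise [S] contains the lower one and misses the upper one. *)
have [/existsP [z /andP [/eqP zL Sz]]|] :=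
    boolP [exists z : V, (lcoord (val z) s == lcoord x s) && ~~ S (val z)].
  by apply: (split_level x (val z) s) => //; exact: valP.
rewrite negb_exists => /forallP Slow.
have [/existsP [z /andP [/eqP zL Sz]]|] :=
    boolP [exists z : V, (lcoord (val z) s == lcoord x s + 1) && S (val z)].
  by apply: (split_level (val z) (x + level_move s g) s); rewrite ?yL //; exact: valP.
rewrite negb_exists => /forallP Shigh.
have xy : lcoord x s < lcoord (x + level_move s g) s by rewrite yL; lia.
have [|z zV zL|C CS CI] := level_edges xV yV xy (S := S).
- move=> z zV zL; by have := Slow [` zV]; rewrite negb_and zL eqxx negbK.
- by have := Shigh [` zV]; rewrite negb_and zL eqxx.
exists C => //; rewrite CI; apply: (min_degree_bound (s := s)) => //.
by exists (x + level_move s g).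
Qed.

End MinDegree.
End Fiber.

(** * Finiteness of the fiber *)

Lemma fiber_finite b : (exists u, in_fiber (A_k k) b u) ->
  exists V : {fset 'cV[int]_((4 * k).+2)}, forall u, u \in V <-> in_fiber (A_k k) b u.
Proof.
(* If the entries of [u0] are at most m, all levels in the fiber are at most 2m, and a pair sum,
   which differs from that of [u0] by the change of level, is at most 2m + 2m. *)
case=> u0 f0; pose m := (\max_c absz (u0 c 0)%R)%N; pose M := (4 * m)%N.
have u0M c : u0 c 0 <= m%:Z.
  by have := leq_bigmax (F := fun c => absz (u0 c 0)) c; rewrite -/m; lia.
pose vecs := [seq \col_c (f c : nat)%:Z | f : {ffun 'I_((4 * k).+2) -> 'I_M.+1}].
pose infib u := [forall c, 0 <= u c 0] && (A_k k *m u == b).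
have infibP u : reflect (in_fiber (A_k k) b u) (infib u).
  by apply: (iffP andP) => -[]; [move=> /forallP ? /eqP | move=> ? ->; split=> //; exact/forallP].
exists (seq_fset tt [seq u <- vecs | infib u]) => u; rewrite seq_fsetE mem_filter.
split=> [/andP [/infibP //]|fu]; apply/andP; split; first exact/infibP.
have uM : forall c, u c 0 <= M%:Z.
  have lM s : lcoord u s <= (2 * m)%N%:Z.
    have := fiber_levels s s fu f0; have := fiber_lge0 (~~ s) fu.
    by have := u0M (slot_col (inr s)); have := u0M (slot_col (inr (~~ s))); rewrite /lcoord; lia.
  apply: forall_slot => [j t|s]; last by have := lM s; rewrite /lcoord /M; lia.
  have := fiber_pair j t t fu f0; have := fiber_ge0 j (~~ t) fu; have := lM j.1.
  have := fiber_lge0 j.1 f0.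
  have := u0M (slot_col (inl (j, t))); have := u0M (slot_col (inl (j, ~~ t))).
  by rewrite /pcoord /M; lia.
apply/mapP; exists [ffun c => inord (absz (u c 0))]; rewrite ?mem_enum //.
have [u_ge0 _] := fu; apply/matrixP=> c c'; rewrite ord1 mxE ffunE inordK.
  by rewrite gez0_abs.
by rewrite ltnS -lez_nat gez0_abs.
Qed.

End Coordinates.

Theorem theorem4 (k : nat) (b : 'cV[int]_((2 * k).+1)) :
  (1 <= k)%N ->
  (exists u, in_fiber (A_k k) b u) ->
  exists V : {fset 'cV[int]_((4 * k).+2)},
    (forall u, u \in V <-> in_fiber (A_k k) b u) /\
    exists d : nat,
      is_min_degree V (fiber_adj (graver (A_k k))) d /\
      is_edge_connectivity V (fiber_adj (graver (A_k k))) d.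
Proof.
move=> _ fibne; have [V VP] := fiber_finite fibne.
have V0 : V != fset0 by case: fibne => u /VP uV; apply/fset0Pn; exists u.
have [d dmin] := min_degree_exists (@fiber_adjP k) V0.
exists V; split=> //; exists d; split=> //.
apply: (edge_connectivity_of_cuts (@fiber_adjP k) (@adj_irrefl k) dmin) => S u v uV Su vV Sv.
exact: (fiber_cut VP dmin uV Su vV Sv).
Qed.
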